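(* Let $n\ge3$ and let $A\in\mathbb{R}^{n\times n}$ be a nonsingular diagonal matrix. Then the function $q_A:\mathbb{S}^{n-1}\cap\mathbb{R}^n_{++}\to\mathbb{R}$, $q_A(x)=\langle Ax,x\rangle$, is merely spherically quasi-convex if and only if $A$ has only two (i.e. exactly two distinct) eigenvalues, such that its smallest one has multiplicity one and has a corresponding eigenvector with all components nonnegative.
   Context: $\mathbb{S}^{n-1}=\{x\in\mathbb{R}^n:\|x\|=1\}$ and $\mathbb{R}^n_{++}$ is the set of vectors with positive entries. For $x,y\in\mathbb{S}^{n-1}$ with $y\ne\pm x$ the minimal geodesic from $x$ to $y$ is the constant-speed parametrization of the shorter great-circle arc: with $d=\arccos\langle x,y\rangle$, $\gamma_{xy}(t)=\bigl(\cos(td)-\tfrac{\langle x,y\rangle\sin(td)}{\sqrt{1-\langle x,y\rangle^2}}\bigr)x+\tfrac{\sin(td)}{\sqrt{1-\langle x,y\rangle^2}}y$, $t\in[0,1]$. A function $f:\mathcal{S}\to\mathbb{R}$ on $\mathcal{S}=\mathbb{S}^{n-1}\cap\mathbb{R}^n_{++}$ is spherically quasi-convex (respectively spherically convex) if for every minimal geodesic segment $\gamma:[0,1]\to\mathcal{S}$ the composition $f\circ\gamma$ is quasi-convex (respectively convex) in the usual sense. It is merely spherically quasi-convex if it is spherically quasi-convex but not spherically convex. *)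

(* Defs.v *)
From HB Require Import structures.
From mathcomp Require Export all_boot all_order all_algebra.
From mathcomp Require Export all_classical all_reals all_analysis.

Set Implicit Arguments.
Unset Strict Implicit.
Unset Printing Implicit Defensive.

Import Order.TTheory GRing.Theory Num.Theory.
Import numFieldNormedType.Exports.

Local Open Scope classical_set_scope.
Local Open Scope ring_scope.
Local Open Scope convex_scope.

(* The library's norm on matrices is the max-norm, hence the explicit Euclidean
   inner product and norm here. *)
Definition dotv (R : realType) (n : nat) (x y : 'cV[R]_n) : R :=
  \sum_(i < n) x i 0 * y i 0.

Definition enorm (R : realType) (n : nat) (x : 'cV[R]_n) : R :=
  Num.sqrt (dotv x x).

Definition unit_sphere (R : realType) (n : nat) : set 'cV[R]_n :=
  [set x : 'cV[R]_n | enorm x = 1].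

Definition pos_orthant (R : realType) (n : nat) : set 'cV[R]_n :=
  [set x : 'cV[R]_n | forall i : 'I_n, 0 < x i 0].

Definition pos_sphere (R : realType) (n : nat) : set 'cV[R]_n :=
  @unit_sphere R n `&` @pos_orthant R n.

(* Meaningful only for x and y on the unit sphere with y <> x and y <> - x. *)
Definition geodesic (R : realType) (n : nat) (x y : 'cV[R]_n) (t : R) :
    'cV[R]_n :=
  let c := dotv x y in
  let d := acos c in
  (cos (t * d) - c * sin (t * d) / Num.sqrt (1 - c ^+ 2)) *: x
  + (sin (t * d) / Num.sqrt (1 - c ^+ 2)) *: y.

Definition quasiconvex_function (R : realType) (D : set R^o) (g : R^o -> R^o) :=
  forall t : {i01 R},
    {in D &, forall u v : convex_lmodType R^o,
      (g (u <| t |> v) <= Num.max (g u) (g v))%R}.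

(* Functions on D are represented by total functions on R^n; only their values
   on D matter, since a geodesic is considered only if it stays in D. *)
Definition on_geodesics (R : realType) (n : nat) (D : set 'cV[R]_n)
    (P : (R -> 'cV[R]_n) -> Prop) : Prop :=
  forall x y : 'cV[R]_n,
    unit_sphere x -> unit_sphere y -> y <> x -> y <> - x ->
    (forall t : R, 0 <= t <= 1 -> D (geodesic x y t)) ->
    P (geodesic x y).

Definition spherically_convex (R : realType) (n : nat) (D : set 'cV[R]_n)
    (f : 'cV[R]_n -> R) : Prop :=
  on_geodesics D (fun gamma =>
    convex_function (E := R^o) `[0, 1] (fun t => f (gamma t))).

Definition spherically_quasiconvex (R : realType) (n : nat)
    (D : set 'cV[R]_n) (f : 'cV[R]_n -> R) : Prop :=
  on_geodesics D (fun gamma =>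
    quasiconvex_function `[0, 1] (fun t => f (gamma t))).

Definition merely_spherically_quasiconvex (R : realType) (n : nat)
    (D : set 'cV[R]_n) (f : 'cV[R]_n -> R) : Prop :=
  spherically_quasiconvex D f /\ ~ spherically_convex D f.

Definition quad_form (R : realType) (n : nat) (A : 'M[R]_n) (x : 'cV[R]_n) : R :=
  dotv (A *m x) x.

(* [eigenvalue] is defined through row vectors, v *m A = a *: v, but has the
   same meaning for column vectors since A and A^T have the same spectrum;
   eigenvectors are column vectors here. *)
Definition eigenvector (R : realType) (n : nat) (A : 'M[R]_n) (a : R)
    (v : 'cV[R]_n) : Prop :=
  v <> 0 /\ A *m v = a *: v.

(* Main.v *)
Require Import Defs.
From mathcomp Require Import all_boot all_order all_algebra.
From mathcomp Require Import all_classical all_reals all_analysis.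
From mathcomp Require Import ring lra.

Import Order.TTheory GRing.Theory Num.Theory.
Local Open Scope ring_scope.

Import numFieldNormedType.Exports.
Local Open Scope classical_set_scope.
Local Open Scope convex_scope.

(** Write [l_i] for the diagonal entries of [A], so that
    [q x = \sum_i l_i x_i^2].

    If all [l_i] coincide, [q] is constant on the sphere, hence convex.  So
    mere quasi-convexity forces two distinct eigenvalues.  The heart of the
    necessity is that no entry [l_k] can have two smaller entries [l_i], [l_j]
    with [i != j] (lemma [sqc_smaller_entry_unique]).  Choose a level [m] with
    [l_i, l_j < m < l_k].  There are unit vectors [x = p e_i + z e_k] and
    [y = q e_j + w e_k], nonnegative, both exactly on the level [m], and the
    only common coordinate is the [k]-th one.  At their midpoint [q] exceeds
    [m], because the cross term of the form [q - m |.|^2] is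
    [2 (l_k - m) z w > 0].  These vectors lie on the boundary of the open
    orthant; since the midpoint of the arc from [x] to [y] is [x + y] up to
    normalisation, quasi-convexity at midpoints is an inequality between
    continuous functions of [x] and [y], and it passes to the boundary
    (lemma [sqc_midpoint_nonneg]).  Applied with [i] the place of the minimum,
    this forces all the other entries to be equal.

    Conversely, if [l_{i0} = a] and all other entries are [b > a], then
    [q x = b - (b - a) x_{i0}^2] on the sphere, so everything depends on the
    coordinate [x_{i0} > 0] alone.  Along a great circle this coordinate is a
    sinusoid; where it is positive its values in between two points are at least
    the minimum at these points (lemma [geodesic_coord_min]), so [q] is
    quasi-convex.  It is not convex: an explicit pair of points violates
    midpoint convexity (lemma [one_smaller_not_convex]). *)

(** * The Euclidean inner product *)

Section InnerProduct.
Context {R : realType} {n : nat}.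
Implicit Types x y z : 'cV[R]_n.

Lemma dotvC x y : dotv x y = dotv y x.
Proof. by apply: eq_bigr => i _; rewrite mulrC. Qed.

Lemma dotvDl x y z : dotv (x + y) z = dotv x z + dotv y z.
Proof. by rewrite -big_split; apply: eq_bigr => i _; rewrite mxE mulrDl. Qed.

Lemma dotvDr x y z : dotv x (y + z) = dotv x y + dotv x z.
Proof. by rewrite dotvC dotvDl !(dotvC x). Qed.

Lemma dotvZl (k : R) x y : dotv (k *: x) y = k * dotv x y.
Proof. by rewrite mulr_sumr; apply: eq_bigr => i _; rewrite mxE mulrA. Qed.

Lemma dotvZr (k : R) x y : dotv x (k *: y) = k * dotv x y.
Proof. by rewrite dotvC dotvZl dotvC. Qed.

Lemma dotv_sqrD x y :
  dotv (x + y) (x + y) = dotv x x + 2 * dotv x y + dotv y y.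
Proof. by rewrite dotvDl !dotvDr (dotvC y x); ring. Qed.

Lemma dotv_ge0 x : 0 <= dotv x x.
Proof. by apply: sumr_ge0 => i _; rewrite -expr2 sqr_ge0. Qed.

Lemma dotv_eq0 x : dotv x x = 0 -> x = 0.
Proof.
move=> /eqP; rewrite psumr_eq0; last by move=> i _; rewrite -expr2 sqr_ge0.
move=> /allP x0; apply/colP => i; rewrite mxE.
by have := x0 i (mem_index_enum i); rewrite /= -expr2 sqrf_eq0 => /eqP.
Qed.

Lemma unit_sphereE x : unit_sphere x <-> dotv x x = 1.
Proof.
rewrite /unit_sphere /enorm /=; split=> [|->]; last exact: sqrtr1.
by move=> nx; rewrite -(sqr_sqrtr (dotv_ge0 x)) nx expr1n.
Qed.

(** Strict Cauchy-Schwarz for unit vectors: [|y + x|^2] and [|y - x|^2] are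
    positive. *)
Lemma dotv_unit_lt x y : unit_sphere x -> unit_sphere y ->
  y <> x -> y <> - x -> -1 < dotv x y < 1.
Proof.
move=> /unit_sphereE x1 /unit_sphereE y1 yx yNx; apply/andP; split.
  rewrite ltNge; apply/negP => cN1; apply: yNx.
  have e := dotv_ge0 (y + x); apply/eqP; rewrite -addr_eq0; apply/eqP/dotv_eq0.
  by move: e; rewrite !dotvDl !dotvDr x1 y1 (dotvC y x); lra.
rewrite ltNge; apply/negP => c1; apply: yx.
have e := dotv_ge0 (y + (-1) *: x).
apply/eqP; rewrite -subr_eq0 -scaleN1r; apply/eqP/dotv_eq0.
by move: e; rewrite !dotvDl !dotvDr !dotvZl !dotvZr x1 y1 (dotvC y x); lra.
Qed.

End InnerProduct.

(** * Geodesics of the sphere *)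

Section Geodesics.
Context {R : realType} {n : nat}.
Implicit Types x y z : 'cV[R]_n.

Lemma sin_acos_gt0 {c : R} : -1 < c < 1 -> 0 < sin (acos c).
Proof.
move=> /andP[c1 c2]; apply: sin_gt0_pi.
by rewrite acos_gt0 ?acos_ltpi// ?(ltW c1) ?(ltW c2) ?c1 ?c2.
Qed.

Lemma cos_acos {c : R} : -1 < c < 1 -> cos (acos c) = c.
Proof. by move=> /andP[c1 c2]; rewrite acosK// in_itv /= !ltW. Qed.

(** The second vector is the unit tangent at [x] pointing towards [y]. *)
Lemma geodesicE x y t : -1 < dotv x y < 1 ->
  let d := acos (dotv x y) in
  geodesic x y t = cos (t * d) *: x
    + sin (t * d) *: ((sin d)^-1 *: (y - dotv x y *: x)).
Proof.
move=> cc d; rewrite /geodesic -/d -sin_acos -/d; last first.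
  by case/andP: cc => c1 c2; rewrite !ltW.
apply/colP => i; rewrite !mxE; ring.
Qed.

(** Any three points of a great circle are linearly dependent. By [geodesicE]
    it suffices to check the relation on [cos (t d)] and on [sin (t d)], where
    it is the addition formula. *)
Lemma geodesic_three_points x y u w v : -1 < dotv x y < 1 ->
  let d := acos (dotv x y) in
  sin (v * d - u * d) *: geodesic x y w
    = sin (v * d - w * d) *: geodesic x y u
      + sin (w * d - u * d) *: geodesic x y v.
Proof.
move=> cc /=; rewrite !geodesicE// !sinB.
by apply/colP => i; rewrite !mxE; ring.
Qed.

Lemma geodesic_coord_three_points x y i u w v : -1 < dotv x y < 1 ->
  let d := acos (dotv x y) in
  sin (v * d - u * d) * geodesic x y w i 0
    = sin (v * d - w * d) * geodesic x y u i 0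
      + sin (w * d - u * d) * geodesic x y v i 0.
Proof.
move=> cc; have /= := geodesic_three_points x y u w v cc.
move: (geodesic x y u) (geodesic x y w) (geodesic x y v) => gu gw gv.
by move=> /colP/(_ i); rewrite !mxE.
Qed.

Lemma geodesic0 x y : geodesic x y 0 = x.
Proof.
rewrite /geodesic !mul0r sin0 cos0 mulr0 !mul0r.
by rewrite subr0 scale1r scale0r addr0.
Qed.

Lemma geodesic1 x y : -1 < dotv x y < 1 -> geodesic x y 1 = y.
Proof.
move=> cc; rewrite geodesicE// mul1r cos_acos//.
rewrite scalerA divff ?gt_eqF ?sin_acos_gt0// scale1r.
by rewrite addrC subrK.
Qed.

Lemma geodesic_unit x y t : -1 < dotv x y < 1 ->
  unit_sphere x -> unit_sphere y -> unit_sphere (geodesic x y t).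
Proof.
move=> cc /unit_sphereE x1 /unit_sphereE y1; apply/unit_sphereE.
rewrite geodesicE//; set d := acos _.
have s0 : sin d != 0 by rewrite gt_eqF ?sin_acos_gt0.
have cd : cos d = dotv x y := cos_acos cc.
have := cos2Dsin2 d; rewrite cd; have := cos2Dsin2 (t * d).
rewrite -scaleNr !(dotvDl, dotvDr, dotvZl, dotvZr) x1 y1 (dotvC y x).
move: (cos _) (sin (_ * _)) (sin d) s0 (dotv x y) => p q s s0 c pq cs.
transitivity (p ^+ 2 + q ^+ 2 * ((1 - c ^+ 2) / s ^+ 2)); first by field.
have -> : 1 - c ^+ 2 = s ^+ 2 by rewrite -cs; ring.
by rewrite divff ?mulr1// expf_neq0.
Qed.

(** The factor [g] is [1 / (2 cos (d / 2))], that is [1 / |x + y|]. *)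
Lemma geodesic_mid x y : -1 < dotv x y < 1 ->
  exists2 g : R, geodesic x y 2^-1 = g *: (x + y)
    & g ^+ 2 * (2 + 2 * dotv x y) = 1.
Proof.
move=> cc; set d := acos (dotv x y).
have s0 : 0 < sin d by exact: sin_acos_gt0.
have dE : d = (2^-1 * d) *+ 2 by rewrite -mulr_natl; field.
have sE : sin d = 2 * cos (2^-1 * d) * sin (2^-1 * d).
  by rewrite [in LHS]dE sin_mulr2n -mulr_natl mulrA.
have h0 : sin (2^-1 * d) != 0.
  by apply/eqP => e; move: s0; rewrite sE e mulr0 ltxx.
have c0 : cos (2^-1 * d) != 0.
  by apply/eqP => e; move: s0; rewrite sE e mulr0 mul0r ltxx.
exists (2 * cos (2^-1 * d))^-1.
  have /= := geodesic_three_points x y 0 2^-1 1 cc.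
  rewrite -/d !mul0r mul1r !subr0.
  rewrite geodesic0 geodesic1// [X in sin (X - _)]dE mulr2n addrK -scalerDr.
  move=> /(congr1 (fun w => (sin d)^-1 *: w)).
  rewrite !scalerA mulVf ?gt_eqF// scale1r => ->.
  by congr (_ *: _); rewrite sE; field; rewrite h0 c0.
have <- : cos d = dotv x y := cos_acos cc.
rewrite [in cos d]dE cos_mulr2n.
by field.
Qed.

Lemma angle_le_pi {c u v : R} : -1 < c < 1 -> 0 <= u -> u <= v -> v <= 1 ->
  0 <= v * acos c - u * acos c <= pi.
Proof.
move=> /andP[c1 c2] u0 uv v1.
have d0 : 0 < acos c by rewrite acos_gt0 ?(ltW c1).
have dp : acos c < pi by rewrite acos_ltpi ?c1 ?ltW.
apply/andP; split; first by rewrite subr_ge0 ler_pM2r.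
rewrite -mulrBl (le_trans _ (ltW dp))// ler_piMl ?(ltW d0)//; lra.
Qed.

(** The arc between two points of the positive orthant stays there, being made
    of nonnegative combinations of its endpoints. *)
Lemma geodesic_pos x y t : -1 < dotv x y < 1 ->
  pos_sphere x -> pos_sphere y -> 0 <= t <= 1 -> pos_sphere (geodesic x y t).
Proof.
move=> cc [x1 x0] [y1 y0] /andP[t0 t1]; split; first exact: geodesic_unit.
move=> i.
have s0 := sin_acos_gt0 cc.
have /= := geodesic_coord_three_points x y i 0 t 1 cc.
rewrite !mul0r !subr0 geodesic0 geodesic1// mul1r => e.
rewrite -(pmulr_rgt0 _ s0) e.
have p0 : 0 <= sin (acos (dotv x y) - t * acos (dotv x y)).
  by apply: sin_ge0_pi; rewrite -[X in X - _]mul1r; apply: angle_le_pi.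
have q0 : 0 <= sin (t * acos (dotv x y)).
  apply: sin_ge0_pi; have := angle_le_pi cc (lexx 0) t0 t1.
  by rewrite mul0r subr0.
(* If both coefficients vanished, so would [sin d] by the addition formula. *)
rewrite lt_neqAle addr_ge0 ?mulr_ge0 ?(ltW (x0 _)) ?(ltW (y0 _))// andbT eq_sym.
rewrite paddr_eq0 ?mulr_ge0 ?(ltW (x0 _)) ?(ltW (y0 _))// !mulf_eq0.
rewrite !(gt_eqF (x0 i)) !(gt_eqF (y0 i)) !orbF.
apply/negP => /andP[/eqP p /eqP q].
move: s0; have -> : sin (acos (dotv x y))
  = sin ((acos (dotv x y) - t * acos (dotv x y)) + t * acos (dotv x y)).
  by rewrite subrK.
by rewrite sinD p q mul0r mulr0 addr0 ltxx.
Qed.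

End Geodesics.

(** * Midpoints and convexity *)

(** The weight 1/2, for the two structures of convex space on [R] under which
    arguments and values of a function are averaged. *)
Lemma half_conv {R : realType} :
  exists h : {i01 R}, (0 : convex_lmodType R^o) <| h |> 1 = 2^-1 :> R
  /\ forall a b : R, (a : R^o) <| h |> b = 2^-1 * (a + b) :> R.
Proof.
have h0 : (0 : R) <= 2^-1 by lra.
have h1 : (2^-1 : R) <= 1 by lra.
exists (Itv01 h0 h1); split=> [|a b].
  by transitivity (2^-1 * 0 + (1 - 2^-1) * 1 : R); [|lra].
by transitivity (2^-1 * a + (1 - 2^-1) * b : R); [|lra].
Qed.

Lemma mem0_itv01 {R : realType} :
  (0 : convex_lmodType R^o) \in (`[0, 1] : set R^o).
Proof. by rewrite inE /= in_itv /= lexx ler01. Qed.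

Lemma mem1_itv01 {R : realType} :
  (1 : convex_lmodType R^o) \in (`[0, 1] : set R^o).
Proof. by rewrite inE /= in_itv /= lexx ler01. Qed.

Lemma quasiconvex_mid {R : realType} (g : R^o -> R^o) :
  quasiconvex_function `[0, 1] g -> g 2^-1 <= Num.max (g 0) (g 1).
Proof.
have [h [hm _]] := @half_conv R.
by move=> /(_ h _ _ mem0_itv01 mem1_itv01); rewrite hm.
Qed.

Lemma convex_mid {R : realType} (g : R^o -> R^o) :
  convex_function (E := R^o) `[0, 1] g -> g 2^-1 <= 2^-1 * (g 0 + g 1).
Proof.
have [h [hm hc]] := @half_conv R.
by move=> /(_ h _ _ mem0_itv01 mem1_itv01); rewrite hm hc.
Qed.

Lemma conv_itv01 {R : realType} (t : {i01 R}) (u v : R) :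
  0 <= u <= 1 -> 0 <= v <= 1 ->
  0 <= ((u : convex_lmodType R^o) <| t |> v : R) <= 1.
Proof.
have -> : (u : convex_lmodType R^o) <| t |> v
  = t%:num * u + (1 - t%:num) * v :> R by [].
have t0 : 0 <= t%:num by []. have t1 : t%:num <= 1 by [].
by move=> /andP[u0 u1] /andP[v0 v1]; apply/andP; split; nra.
Qed.

Section Midpoints.
Context {R : realType} {n : nat} (A : 'M[R]_n).
Implicit Types x y : 'cV[R]_n.

Lemma pos_sphere_opp x y : (0 < n)%N ->
  pos_sphere x -> pos_sphere y -> y <> - x.
Proof.
move=> n0 [_ x0] [_ y0] e.
have := x0 (Ordinal n0); have := y0 (Ordinal n0).
by rewrite e mxE oppr_gt0 => /lt_trans /[apply]; rewrite ltxx.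
Qed.

Lemma quad_formZ (k : R) x : quad_form A (k *: x) = k ^+ 2 * quad_form A x.
Proof. by rewrite /quad_form -scalemxAr dotvZl dotvZr mulrA. Qed.

Lemma quad_formD x y : quad_form A (x + y) =
  quad_form A x + quad_form A y + (dotv (A *m x) y + dotv (A *m y) x).
Proof. by rewrite /quad_form mulmxDr dotvDl !dotvDr; ring. Qed.

(** The normalisation of the midpoint is cleared on both sides, which leaves an
    inequality polynomial in the coordinates up to the maximum. *)
Lemma sqc_midpoint x y : (0 < n)%N ->
  spherically_quasiconvex (@pos_sphere R n) (quad_form A) ->
  pos_sphere x -> pos_sphere y ->
  quad_form A (x + y)
    <= Num.max (quad_form A x) (quad_form A y) * dotv (x + y) (x + y).
Proof.
move=> n0 qc xP yP.
have /unit_sphereE x1 := xP.1; have /unit_sphereE y1 := yP.1.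
have -> : dotv (x + y) (x + y) = 2 + 2 * dotv x y.
  by rewrite dotv_sqrD x1 y1; ring.
have [->|/eqP yx] := eqVneq y x.
  rewrite maxxx x1 -mulr2n -scaler_nat quad_formZ; lra.
have yNx := pos_sphere_opp x y n0 xP yP.
have cc := dotv_unit_lt _ _ xP.1 yP.1 yx yNx.
have := quasiconvex_mid _ (qc x y xP.1 yP.1 yx yNx
  (fun t => geodesic_pos x y t cc xP yP)).
rewrite geodesic0 geodesic1//.
have [g -> gE] := geodesic_mid x y cc.
rewrite quad_formZ => H.
have c0 : 0 < 2 + 2 * dotv x y by case/andP: cc; lra.
have := H; rewrite -(ler_pM2r c0); rewrite mulrAC gE mul1r; exact.
Qed.

(** The inequality of [sqc_midpoint] is closed, so it extends to the boundary of
    the orthant: [X z e] is the normalisation of [z] with [e] added to every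
    coordinate, a positive unit vector that tends to [z] as [e] tends to 0
    from the right. *)
Lemma sqc_midpoint_nonneg x y : (0 < n)%N ->
  spherically_quasiconvex (@pos_sphere R n) (quad_form A) ->
  unit_sphere x -> unit_sphere y ->
  (forall i, 0 <= x i 0) -> (forall i, 0 <= y i 0) ->
  quad_form A (x + y)
    <= Num.max (quad_form A x) (quad_form A y) * dotv (x + y) (x + y).
Proof.
move=> n0 qc x1 y1 x0 y0.
pose X (z : 'cV[R]_n) (e : R) : 'cV[R]_n :=
  (enorm (z + const_mx e))^-1 *: (z + const_mx e).
have XP (z : 'cV[R]_n) e :
    (forall i, 0 <= z i 0) -> 0 < e -> pos_sphere (X z e).
  move=> z0 e0.
  have p i : 0 < (z + const_mx e) i 0 by rewrite !mxE ltr_wpDl.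
  have q : 0 < dotv (z + const_mx e) (z + const_mx e).
    rewrite lt_neqAle dotv_ge0 andbT eq_sym; apply/eqP => /dotv_eq0.
    move=> /colP/(_ (Ordinal n0)); rewrite [in RHS]mxE => e'.
    by have := p (Ordinal n0); rewrite e' ltxx.
  split; last by move=> i; rewrite mxE mulr_gt0// invr_gt0 sqrtr_gt0.
  apply/unit_sphereE; rewrite /X dotvZl dotvZr mulrA -expr2 exprVn.
  by rewrite sqr_sqrtr ?dotv_ge0// mulVf// gt_eqF.
have cvg_dotv (U V : R -> 'cV[R]_n) (u v : 'cV[R]_n) :
    (forall i, U e i 0 @[e --> 0^'+] --> u i 0) ->
    (forall i, V e i 0 @[e --> 0^'+] --> v i 0) ->
    dotv (U e) (V e) @[e --> (0:R)^'+] --> dotv u v.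
  move=> Uu Vv; apply: cvg_big => [|i _]; first exact: add_continuous.
  exact: cvgM.
have cvgX (z : 'cV[R]_n) : unit_sphere z ->
    forall i, X z e i 0 @[e --> (0:R)^'+] --> z i 0.
  move=> z1 i.
  have cD j : (z + const_mx e) j 0 @[e --> (0:R)^'+] --> z j 0.
    under eq_fun do rewrite !mxE.
    suff: z j 0 + e @[e --> (0:R)^'+] --> z j 0 + 0 by rewrite addr0.
    apply: cvgD; first exact: cvg_cst.
    by apply: cvg_at_right_filter; exact: cvg_id.
  have cN : enorm (z + const_mx e) @[e --> (0:R)^'+] --> (1 : R).
    have <- : enorm z = 1 by exact: z1.
    have cS : {for dotv z z, continuous (Num.sqrt : R -> R)}.
      exact: sqrt_continuous.
    have K := @continuous_cvg _ _ _ ((0:R)^'+) _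
      (fun e => dotv (z + const_mx e) (z + const_mx e)) _ _ cS.
    by apply: K; exact: cvg_dotv.
  under eq_fun do rewrite mxE.
  suff: (enorm (z + const_mx e))^-1 * (z + const_mx e) i 0
      @[e --> (0:R)^'+] --> 1^-1 * z i 0 by rewrite invr1 mul1r.
  by apply: cvgM => //; apply: cvgV => //; exact: oner_neq0.
have cvg_q (U : R -> 'cV[R]_n) (u : 'cV[R]_n) :
    (forall i, U e i 0 @[e --> 0^'+] --> u i 0) ->
    quad_form A (U e) @[e --> (0:R)^'+] --> quad_form A u.
  move=> Uu; apply: cvg_dotv => // i.
  under eq_fun do rewrite mxE; rewrite mxE.
  apply: cvg_big => [|j _]; first exact: add_continuous.
  by apply: cvgM => //; exact: cvg_cst.
have cvgXY i : (X x e + X y e) i 0 @[e --> (0:R)^'+] --> (x + y) i 0.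
  under eq_fun do rewrite mxE; rewrite mxE.
  by apply: cvgD; exact: cvgX.
have cvg_m : Num.max (quad_form A (X x e)) (quad_form A (X y e))
    @[e --> (0:R)^'+] --> Num.max (quad_form A x) (quad_form A y).
  have qX z : unit_sphere z ->
      quad_form A (X z e) @[e --> (0:R)^'+] --> quad_form A z.
    by move=> z1; apply: cvg_q; exact: cvgX.
  under eq_fun do rewrite maxr_absE; rewrite maxr_absE.
  apply: cvgM; last exact: cvg_cst.
  apply: cvgD; first by apply: cvgD; exact: qX.
  by apply: cvg_norm; apply: cvgB; exact: qX.
apply: (ler_cvg_to (cvg_q _ _ cvgXY)
  (cvgM cvg_m (cvg_dotv _ _ _ _ cvgXY cvgXY))).
near=> e.
have e0 : 0 < e by near: e; exact: nbhs_right_gt.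
by apply: sqc_midpoint => //; apply: XP.
Unshelve. all: by end_near.
Qed.

End Midpoints.

(** * Positive coordinates along a geodesic *)

(** By the three-point relation, with [P] and [Q] the angles from the middle
    point to the others, [sin (P + Q) g(w) = sin P g(u) + sin Q g(v)], and
    [sin (P + Q) <= sin P + sin Q] since cosines are at most 1. *)
Lemma geodesic_coord_min {R : realType} {n : nat} (x y : 'cV[R]_n) (i : 'I_n)
    (u w v : R) :
  -1 < dotv x y < 1 -> 0 <= u -> u <= w -> w <= v -> v <= 1 ->
  0 <= geodesic x y u i 0 -> 0 <= geodesic x y v i 0 ->
  Num.min (geodesic x y u i 0) (geodesic x y v i 0) <= geodesic x y w i 0.
Proof.
move=> cc u0 uw wv v1 gu gv.
have [uv|vu] := ltP u v; last first.
  have -> : w = u by apply/le_anti; rewrite uw (le_trans wv vu).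
  by rewrite ge_min lexx.
set d := acos (dotv x y).
have /andP[c1 c2] := cc.
have d0 : 0 < d by rewrite acos_gt0 ?(ltW c1).
have dp : d < pi by rewrite acos_ltpi ?c1 ?ltW.
have P : 0 <= v * d - w * d <= pi := angle_le_pi cc (le_trans u0 uw) wv v1.
have Q : 0 <= w * d - u * d <= pi := angle_le_pi cc u0 uw (le_trans wv v1).
have s0 : 0 < sin (v * d - u * d).
  apply: sin_gt0_pi; rewrite -mulrBl mulr_gt0 ?subr_gt0//=.
  by rewrite (le_lt_trans _ dp)// ler_piMl ?(ltW d0)//; lra.
have /= := geodesic_coord_three_points x y i u w v cc.
rewrite -/d; set m := Num.min _ _ => E.
have m0 : 0 <= m by rewrite le_min gu gv.
rewrite -(ler_pM2l s0) E.
have mu : m <= geodesic x y u i 0 by rewrite ge_min lexx.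
have mv : m <= geodesic x y v i 0 by rewrite ge_min lexx orbT.
have sP := sin_ge0_pi P; have sQ := sin_ge0_pi Q.
apply: (@le_trans _ _ (sin (v * d - w * d) * m + sin (w * d - u * d) * m)).
  rewrite -mulrDl ler_wpM2r//.
  have -> : v * d - u * d = (v * d - w * d) + (w * d - u * d) by ring.
  by rewrite sinD lerD// ?ler_piMr ?ler_piMl ?cos_le1.
by rewrite lerD// ler_wpM2l.
Qed.

(** * Diagonal quadratic forms *)

Section BasisVectors.
Context {R : realType} {n : nat}.
Implicit Types x : 'cV[R]_n.

Definition evec i : 'cV[R]_n := delta_mx i 0.

Lemma dotv_evecl i x : dotv (evec i) x = x i 0.
Proof.
rewrite /dotv (bigD1 i)//= big1 ?addr0 => [|j ji]; rewrite !mxE ?eqxx ?mul1r//.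
by rewrite (negbTE ji) mul0r.
Qed.

Lemma dotv_evecr i x : dotv x (evec i) = x i 0.
Proof. by rewrite dotvC dotv_evecl. Qed.

Lemma evecE i j : evec i j 0 = (j == i)%:R.
Proof. by rewrite mxE andbT. Qed.

End BasisVectors.

(** The two equations are linear in [p^2] and [z^2]. *)
Lemma level_point {R : realType} {l h m : R} : l < m -> m < h ->
  exists p z : R,
    [/\ 0 <= p, 0 < z, p ^+ 2 + z ^+ 2 = 1 & l * p ^+ 2 + h * z ^+ 2 = m].
Proof.
move=> lm mh; have lh : 0 < h - l by lra.
exists (Num.sqrt ((h - m) / (h - l))), (Num.sqrt ((m - l) / (h - l))).
have p0 : 0 <= (h - m) / (h - l) by apply: divr_ge0; lra.
have z0 : 0 < (m - l) / (h - l) by apply: divr_gt0; lra.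
rewrite sqrtr_ge0 sqrtr_gt0 z0 !sqr_sqrtr ?(ltW z0)//.
by split=> //; field; rewrite gt_eqF.
Qed.

Section Diagonal.
Context {R : realType} {n : nat} (A : 'M[R]_n) (hdiag : is_diag_mx A).
Implicit Types x y : 'cV[R]_n.

Lemma diag_mulE x i : (A *m x) i 0 = A i i * x i 0.
Proof.
rewrite mxE (bigD1 i)//= big1 ?addr0// => j ji.
by move/is_diag_mxP: hdiag => ->; rewrite ?mul0r// eq_sym.
Qed.

Lemma diag_quad_formE x : quad_form A x = \sum_i A i i * x i 0 ^+ 2.
Proof. by apply: eq_bigr => i _; rewrite diag_mulE expr2 mulrA. Qed.

Lemma diag_char_poly :
  char_poly A = \prod_(y <- [seq A i i | i <- enum 'I_n]) ('X - y%:P).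
Proof. by rewrite char_poly_trig ?is_diag_mx_is_trig// big_map big_enum. Qed.

Lemma diag_eigenvalue c : eigenvalue A c <-> exists i, c = A i i.
Proof.
rewrite eigenvalue_root_char diag_char_poly root_prod_XsubC.
by split=> [/mapP[i _ ->]|[i ->]]; [exists i|apply: map_f; rewrite mem_enum].
Qed.

Lemma diag_mup c : mup c (char_poly A) = #|[pred i | A i i == c]|.
Proof.
rewrite diag_char_poly mu_prod_XsubC count_map -size_filter cardE.
by rewrite enumT /enum_mem; congr size; apply: eq_filter => i; rewrite inE.
Qed.

Lemma diag_evec i : A *m evec i = A i i *: evec i.
Proof.
apply/colP => j; rewrite diag_mulE [RHS]mxE evecE.
by have [->|] := eqVneq j i; rewrite ?mulr0.
Qed.

(** If [A i i] and [A j j] were both below [A k k], the unit vectors [x] and [y]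
    of the proof would lie on a common level [m] strictly in between, and the
    only coordinate that they share, the [k]-th, would push the form above [m]
    at their midpoint. *)
Lemma sqc_smaller_entry_unique i j k : (0 < n)%N ->
  spherically_quasiconvex (@pos_sphere R n) (quad_form A) ->
  i != j -> A i i < A k k -> A k k <= A j j.
Proof.
move=> n0 qc ij ik; rewrite leNgt; apply/negP => jk.
pose m := (Num.max (A i i) (A j j) + A k k) / 2.
have mk : m < A k k.
  by rewrite /m; case: (leP (A i i) (A j j)) => _; lra.
have im : A i i < m.
  by rewrite /m; case: (leP (A i i) (A j j)) => H; lra.
have jm : A j j < m.
  by rewrite /m; case: (leP (A i i) (A j j)) => H; lra.
have [p [z [p0 z0 pz pzm]]] := level_point im mk.
have [q [w [q0 w0 qw qwm]]] := level_point jm mk.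
have ki : (k == i) = false by apply/negP => /eqP e; move: ik; rewrite e ltxx.
have kj : (k == j) = false by apply/negP => /eqP e; move: jk; rewrite e ltxx.
have ikF : (i == k) = false by rewrite eq_sym.
have jkF : (j == k) = false by rewrite eq_sym.
have jiF : (j == i) = false by rewrite eq_sym (negbTE ij).
have ijF := negbTE ij.
have E := (@evecE R n, eqxx, ki, kj, ikF, jkF, jiF, ijF).
pose D := (dotvDl, dotvDr, dotvZl, dotvZr).
pose x := p *: evec i + z *: evec k; pose y := q *: evec j + w *: evec k.
have xx : dotv x x = 1.
  by rewrite /x !D !dotv_evecl !E /= -[RHS]pz; ring.
have yy : dotv y y = 1.
  by rewrite /y !D !dotv_evecl !E /= -[RHS]qw; ring.
have xy : dotv x y = z * w.
  by rewrite /x /y !D !dotv_evecl !E /=; ring.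
have Qx : quad_form A x = m.
  rewrite /quad_form /x mulmxDr -!scalemxAr !diag_evec !D !dotv_evecl !E /=.
  by rewrite -[RHS]pzm; ring.
have Qy : quad_form A y = m.
  rewrite /quad_form /y mulmxDr -!scalemxAr !diag_evec !D !dotv_evecl !E /=.
  by rewrite -[RHS]qwm; ring.
have Qxy : quad_form A (x + y) = 2 * m + 2 * (A k k * (z * w)).
  rewrite quad_formD Qx Qy /x /y.
  rewrite !mulmxDr -!scalemxAr !diag_evec !D !dotv_evecl !E /=; ring.
have ev0 (l l' : 'I_n) : 0 <= (evec l : 'cV[R]_n) l' 0 by rewrite evecE ler0n.
have x0 l : 0 <= x l 0.
  by rewrite mxE [X in X + _]mxE [X in _ + X]mxE addr_ge0// mulr_ge0// ltW.
have y0 l : 0 <= y l 0.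
  by rewrite mxE [X in X + _]mxE [X in _ + X]mxE addr_ge0// mulr_ge0// ltW.
have := sqc_midpoint_nonneg A x y n0 qc _ _ x0 y0.
rewrite Qxy Qx Qy maxxx dotv_sqrD xx yy xy.
move=> /(_ (proj2 (unit_sphereE x) xx) (proj2 (unit_sphereE y) yy)) H.
have zw := mulr_gt0 z0 w0.
have : (A k k - m) * (z * w) <= 0 by lra.
by rewrite pmulr_lle0//; lra.
Qed.

Lemma diag_const_convex (b : R) : (forall i, A i i = b) ->
  spherically_convex (@pos_sphere R n) (quad_form A).
Proof.
move=> Ab x y x1 y1 yx yNx H t u v.
have q1 s : s \in (`[0, 1] : set R^o) -> quad_form A (geodesic x y s) = b.
  rewrite inE /= in_itv /= => s01.
  have [/unit_sphereE g1 _] := H s s01.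
  rewrite diag_quad_formE -[RHS]mulr1 -g1 mulr_sumr.
  by apply: eq_bigr => i _; rewrite Ab expr2.
move=> u01 v01; rewrite (q1 u)// (q1 v)// convmm q1//.
move: u01 v01; rewrite !inE /= !in_itv /=.
exact: conv_itv01.
Qed.

(** ** One entry below all the others, which coincide *)

Section OneSmaller.
Context (a b : R) (i0 : 'I_n) (ab : a < b) (Ai0 : A i0 i0 = a)
  (Ab : forall i, i != i0 -> A i i = b).

Lemma one_smaller_quad_formE x : unit_sphere x ->
  quad_form A x = b - (b - a) * x i0 0 ^+ 2.
Proof.
move=> /unit_sphereE x1; rewrite diag_quad_formE (bigD1 i0)//= Ai0.
have : dotv x x = 1 := x1; rewrite /dotv (bigD1 i0)//= => e.
rewrite (eq_bigr (fun i => b * (x i 0 * x i 0))); last first.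
  by move=> i ii0; rewrite Ab.
rewrite -mulr_sumr.
have -> : \sum_(i | i != i0) x i 0 * x i 0 = 1 - x i0 0 * x i0 0.
  by rewrite -e; ring.
ring.
Qed.

(** A decreasing function of a positive coordinate, which is quasi-concave along
    geodesics. *)
Lemma one_smaller_sqc :
  spherically_quasiconvex (@pos_sphere R n) (quad_form A).
Proof.
move=> x y x1 y1 yx yNx H t u v.
have cc := dotv_unit_lt _ _ x1 y1 yx yNx.
rewrite !inE /= !in_itv /= => u01 v01.
have t0 : 0 <= t%:num by []. have t1 : t%:num <= 1 by [].
pose w : R := t%:num * u + (1 - t%:num) * v.
have -> : (u : convex_lmodType R^o) <| t |> v = w by [].
have w01 : 0 <= w <= 1 := conv_itv01 t u v u01 v01.
have Q s (s01 : 0 <= s <= 1) := one_smaller_quad_formE _ (H s s01).1.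
have P s (s01 : 0 <= s <= 1) := (H s s01).2 i0.
rewrite !Q//.
have K : Num.min (geodesic x y u i0 0) (geodesic x y v i0 0)
    <= geodesic x y w i0 0.
  move: (P u u01) (P v v01) => Pu Pv.
  move: u01 v01 => /andP[u0 u1] /andP[v0 v1].
  have [uv|/ltW vu] := leP u v.
    by apply: geodesic_coord_min => //; rewrite ?(ltW Pu) ?(ltW Pv)// /w; nra.
  rewrite minC.
  by apply: geodesic_coord_min => //; rewrite ?(ltW Pu) ?(ltW Pv)// /w; nra.
have mono s s' : 0 < s -> s <= s' ->
    b - (b - a) * s' ^+ 2 <= b - (b - a) * s ^+ 2.
  move=> s0 ss'; rewrite lerD2l lerN2 ler_pM2l ?subr_gt0//.
  by rewrite ler_pXn2r ?nnegrE ?(ltW s0)// ltW// (lt_le_trans s0).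
move: K; rewrite ge_min => /orP[K|K]; rewrite le_max; apply/orP; [left|right];
  by apply: mono => //; apply: P.
Qed.

(** On a great circle through [e_{i0}], the function [- x_{i0}^2 = - cos^2] is
    strictly concave at angles between [pi / 4] and [pi / 2] from [e_{i0}]. So
    two points of the orthant at such angles violate midpoint convexity. *)
Lemma one_smaller_not_convex : (3 <= n)%N ->
  ~ spherically_convex (@pos_sphere R n) (quad_form A).
Proof.
move=> n3 cvx.
have [w wi0 wi] : exists2 w : 'cV[R]_n,
    w i0 0 = 0 & forall i, i != i0 -> w i 0 = 1.
  exists (\col_i (i != i0)%:R) => [|i ii0]; rewrite mxE ?eqxx//.
  by rewrite ii0.
pose N : R := dotv w w.
have N0 : 0 < N.
  rewrite lt_neqAle dotv_ge0 andbT eq_sym; apply/eqP => /dotv_eq0 w0.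
  have n1 : (1 < n)%N by apply: leq_trans n3.
  have n0 : (0 < n)%N by apply: leq_trans n3.
  have [e|e] := eqVneq (Ordinal n0) i0.
    have := wi (Ordinal n1); rewrite -e w0 mxE => /(_ isT) /esym /eqP.
    by rewrite oner_eq0.
  by have := wi _ e; rewrite w0 mxE => /esym/eqP; rewrite oner_eq0.
pose r := (Num.sqrt N)^-1.
have r0 : 0 < r by rewrite invr_gt0 sqrtr_gt0.
have rN : r ^+ 2 * N = 1 by rewrite exprVn sqr_sqrtr ?ltW// mulVf ?gt_eqF.
(* Coordinates in the orthonormal basis [e_{i0}, r w] of a plane whose points
   with [s, c > 0] are positive. *)
pose pt (s c : R) := s *: evec i0 + (c * r) *: w.
have dotpt s c s' c' : dotv (pt s c) (pt s' c') = s * s' + c * c'.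
  rewrite /pt !(dotvDl, dotvDr, dotvZl, dotvZr) !dotv_evecl dotv_evecr wi0.
  rewrite evecE eqxx -/N -[c * c' in RHS]mulr1 -[X in c * c' * X]rN /=; ring.
have ptE s c i : pt s c i 0 = s * (i == i0)%:R + c * r * w i 0.
  by rewrite mxE [X in X + _]mxE [X in _ + X]mxE evecE.
have pt0 s c : 0 < s -> 0 < c -> forall i, 0 < pt s c i 0.
  move=> s0 c0 i; rewrite ptE.
  have [->|ii0] := eqVneq i i0; first by rewrite wi0 mulr1 mulr0 addr0.
  by rewrite wi// mulr0 add0r mulr1 mulr_gt0.
have pti s c : pt s c i0 0 = s by rewrite ptE wi0 eqxx mulr1 mulr0 addr0.
(* Pythagorean triples keep all the numbers rational: the inner product of [x]
   and [y] is 63/65, and the midpoint has coordinate (64/65) / |x + y|. *)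
pose x := pt (3 / 5) (4 / 5); pose y := pt (5 / 13) (12 / 13).
have xP : pos_sphere x.
  by split; [apply/unit_sphereE; rewrite dotpt; field|apply: pt0; lra].
have yP : pos_sphere y.
  by split; [apply/unit_sphereE; rewrite dotpt; field|apply: pt0; lra].
have xy : dotv x y = 63 / 65 by rewrite dotpt; field.
have cc : -1 < dotv x y < 1 by rewrite xy; lra.
have yx : y <> x.
  move=> e; move: cc; rewrite e; have /unit_sphereE -> := xP.1.
  by rewrite ltxx andbF.
have yNx : y <> - x by apply: pos_sphere_opp => //; apply: leq_trans n3.
have := convex_mid _ (cvx x y xP.1 yP.1 yx yNx
  (fun t => geodesic_pos x y t cc xP yP)).
rewrite geodesic0 geodesic1//.
rewrite !one_smaller_quad_formE; [|exact: yP.1|exact: xP.1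
  |exact: geodesic_unit _ _ _ cc xP.1 yP.1].
have [g -> gE] := geodesic_mid x y cc.
have -> : (g *: (x + y)) i0 0 = g * (64 / 65).
  by rewrite mxE mxE !pti; field.
rewrite !pti exprMn.
have {gE} -> : g ^+ 2 = 65 / 256 by move: gE; rewrite xy; lra.
by move: ab; lra.
Qed.

End OneSmaller.
End Diagonal.

(** * The characterization *)

Theorem theorem5p3p4 (R : realType) (n : nat) (hn : (3 <= n)%N)
    (A : 'M[R]_n) (hdiag : is_diag_mx A) (hns : A \in unitmx) :
  merely_spherically_quasiconvex (@pos_sphere R n) (quad_form A) <->
  (exists a b : R,
    [/\ a < b,
        (forall c : R, eigenvalue A c <-> c = a \/ c = b),
        mup a (char_poly A) = 1%N
      & exists v : 'cV[R]_n,
          eigenvector A a v /\ (forall i : 'I_n, 0 <= v i 0)]).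
Proof.
have n0 : (0 < n)%N by apply: leq_trans hn.
split=> [[qc ncvx]|[a [b [ab spec mult _]]]].
  have [i0 _ i0min] := @Order.TotalTheory.arg_minP _ _ _ (Ordinal n0) xpredT
    (fun i => A i i) isT.
  have [k Ak] : exists k, A i0 i0 < A k k.
    apply: contrapT => nk; apply: ncvx.
    apply: (diag_const_convex A hdiag (A i0 i0)) => i.
    apply/le_anti; rewrite i0min// andbT leNgt.
    by apply/negP => Ai; apply: nk; exists i.
  have Ab i : i != i0 -> A i i = A k k.
    move=> ii0.
    have ki : A k k <= A i i.
      by apply: (sqc_smaller_entry_unique A hdiag i0 i k); rewrite // eq_sym.
    apply/le_anti; rewrite ki andbT.
    have [->//|ik] := eqVneq k i.
    have ki0 : i0 != k by apply/eqP => e; move: Ak; rewrite e ltxx.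
    apply: (sqc_smaller_entry_unique A hdiag i0 k i) => //.
    exact: lt_le_trans Ak ki.
  exists (A i0 i0), (A k k); split=> //.
  - move=> c; rewrite diag_eigenvalue//; split=> [[i ->]|[]->].
    + by have [->|ii0] := eqVneq i i0; [left|right; exact: Ab].
    + by exists i0.
    + by exists k.
  - rewrite diag_mup// -(card1 i0); apply: eq_card => i; rewrite !inE.
    have [->|ii0] := eqVneq i i0; first by rewrite eqxx.
    by rewrite Ab// gt_eqF.
  - exists (evec i0); split; last by move=> i; rewrite evecE ler0n.
    split; last exact: diag_evec.
    by move=> /colP/(_ i0)/eqP; rewrite evecE eqxx mxE oner_eq0.
have /mem_card1[i0 i0P] : #|[pred i | A i i == a]| = 1%N by rewrite -diag_mup.
have Ai0 : A i0 i0 = a by have := i0P i0; rewrite !inE eqxx => /eqP.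
have Ab i : i != i0 -> A i i = b.
  move=> ii0; have [] : A i i = a \/ A i i = b.
  - by apply/spec/diag_eigenvalue => //; exists i.
  - by have := i0P i; rewrite !inE (negbTE ii0) => /eqP.
  - by [].
split.
  exact: (one_smaller_sqc A hdiag a b i0).
exact: (one_smaller_not_convex A hdiag a b i0).
Qed.
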